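(* Let $R$ be an $F$-finite regular domain of characteristic $p>0$ and let $\mathfrak{a}$ be a nonzero proper ideal of $R$. Then the least critical exponent $\operatorname{lce}(\mathfrak{a})$ does not lie in any open interval of the form $\left(\frac{k}{q},\frac{k}{q-1}\right)$, where $q=p^e$ for some integer $e\ge1$, and $k$ is an integer with $0\le k\le q-1$.
   Context: $F$-finite means that $R$ is a finitely generated module over $R^p$. Let $q$ denote a power $p^e$, $e\ge0$. For an ideal $\mathfrak{a}$ of $R$, $\mathfrak{a}^{[q]}=\langle f^q: f\in\mathfrak{a}\rangle$. For $k\in\mathbb{N}$ with base $p$ expansion $k=k_0+k_1p+\cdots+k_rp^r$, $\mathfrak{a}^{[k]}=\mathfrak{a}^{k_0}(\mathfrak{a}^{k_1})^{[p]}\cdots(\mathfrak{a}^{k_r})^{[p^r]}$ (with $\mathfrak{a}^0=R$). $\mathfrak{a}^{[1/q]}$ is the smallest ideal $\mathfrak{c}$ of $R$ with $\mathfrak{a}\subseteq\mathfrak{c}^{[q]}$, and $\mathfrak{a}^{[k/q]}=(\mathfrak{a}^{[k]})^{[1/q]}$ (well defined). For real $t\ge 0$ and $\mathfrak{a}$ nonzero, $\mathfrak{a}^{[t]}=\bigcup_k\mathfrak{a}^{[t_k]}$, where $(t_k)$ is any sequence of rational numbers with $p$-power denominators converging to $t$ monotonically from above, e.g. $t_k=\lceil p^kt\rceil/p^k$ (independent of the sequence). For a nonzero proper ideal $\mathfrak{a}$, the least critical exponent is $\operatorname{lce}(\mathfrak{a})=\sup\{t>0:\mathfrak{a}^{[t]}=R\}=\min\{t>0:\mathfrak{a}^{[t]}\ne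 R\}$. *)

(* Defs.v *)
From HB Require Import structures.
From mathcomp Require Import all_boot all_order all_algebra.
From mathcomp Require Import all_classical all_reals.
Set Implicit Arguments.
Unset Strict Implicit.
Unset Printing Implicit Defensive.
Import Order.TTheory GRing.Theory Num.Theory.
Local Open Scope classical_set_scope.
Local Open Scope ring_scope.

Section Ideals.
Variable A : comNzRingType.
Implicit Types (I J P M : set A) (x y r : A).

(* MathComp's idealr structure only covers proper ideals given by boolean
   predicates; here the whole ring counts as an ideal. *)
Definition is_ideal I :=
  [/\ I 0, forall x y, I x -> I y -> I (x + y) & forall r x, I x -> I (r * x)].

Definition ideal_gen (S : set A) : set A := smallest is_ideal S.

Definition ideal_mul I J : set A :=
  ideal_gen [set z | exists x y, [/\ I x, J y & z = x * y]].

Definition ideal_pow I (n : nat) : set A := iter n (ideal_mul I) setT.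

Definition is_prime P :=
  [/\ is_ideal P, ~ P 1 & forall x y, P (x * y) -> P x \/ P y].

Definition is_maximal M :=
  [/\ is_ideal M, ~ M 1 & forall I, is_ideal I -> M `<=` I -> ~ I 1 -> I = M].

Definition noetherian := forall I, is_ideal I ->
  exists s : seq A, I = ideal_gen [set` s].

Definition has_prime_chain (n : nat) := exists P : nat -> set A,
  (forall i, (i <= n)%N -> is_prime (P i)) /\
  (forall i, (i < n)%N -> P i `<` P i.+1).

Definition has_krull_dim (n : nat) :=
  has_prime_chain n /\ ~ has_prime_chain n.+1.

Definition regular_local :=
  noetherian /\
  exists m : set A, (forall M, is_maximal M <-> M = m) /\
  exists n : nat, has_krull_dim n /\
  exists x : 'I_n -> A, m = ideal_gen (range x).

Record prime_ideal := PrimeIdeal {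
  prime_set : set A;
  prime_setP : is_prime prime_set }.

End Ideals.

Local Notation "x %:F" := (@FracField.tofrac _ x).

Section Localization.
Variables (R : idomainType) (P : prime_ideal R).

Definition loc_pred : {pred {fraction R}} :=
  [pred z | `[< exists a s : R, ~ prime_set P s /\ z = a%:F / s%:F >]].

Let prime_neq0 (s : R) : ~ prime_set P s -> s%:F != 0 :> {fraction R}.
Proof.
have [[P0 _ _] _ _] := prime_setP P.
by move=> Ps; rewrite tofrac_eq0; apply/eqP => s0; apply: Ps; rewrite s0.
Qed.

Let prime_mulN (s t : R) : ~ prime_set P s -> ~ prime_set P t -> ~ prime_set P (s * t).
Proof. by have [_ _ Pmul] := prime_setP P; move=> Ps Pt /Pmul[]. Qed.

Fact loc_subring : subring_closed loc_pred.
Proof.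
have [_ P1 _] := prime_setP P.
split.
- by apply/asboolP; exists 1, 1; split=> //; rewrite !tofrac1 divr1.
- move=> _ _ /asboolP[a [s [Ps ->]]] /asboolP[b [t [Pt ->]]].
  apply/asboolP; exists (a * t - b * s), (s * t); split; first exact: prime_mulN.
  by rewrite -mulNr addf_div ?prime_neq0 // mulNr -!tofracM -tofracB.
- move=> _ _ /asboolP[a [s [Ps ->]]] /asboolP[b [t [Pt ->]]].
  apply/asboolP; exists (a * b), (s * t); split; first exact: prime_mulN.
  by rewrite mulf_div !tofracM.
Qed.

HB.instance Definition _ :=
  GRing.isSubringClosed.Build {fraction R} loc_pred loc_subring.

(* The localization R_P, realized inside the fraction field of the domain R. *)
Definition localization := {z : {fraction R} | z \in loc_pred}.
HB.instance Definition _ := SubChoice.on localization.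
HB.instance Definition _ := [SubChoice_isSubComNzRing of localization by <:].

End Localization.

Definition regular_domain (R : idomainType) :=
  noetherian R /\
  forall P : prime_ideal R, regular_local (localization P : comNzRingType).

Section FrobeniusPowers.
Variables (p : nat) (R : comNzRingType).
Implicit Types a : set R.

(* In characteristic p: R is a finitely generated module over R^p. *)
Definition F_finite := exists (n : nat) (g : 'I_n -> R),
  forall x : R, exists c : 'I_n -> R, x = \sum_(i < n) c i ^+ p * g i.

(* a^[p^e] *)
Definition frob_pow a (e : nat) : set R :=
  ideal_gen [set f ^+ (p ^ e) | f in a].

(* a^[k]; k %/ p ^ i %% p is the i-th base-p digit of k. *)
Definition digit_pow a (k : nat) : set R :=
  \big[@ideal_mul R/setT]_(i < (trunc_log p k).+1)
     frob_pow (ideal_pow a (k %/ p ^ i %% p)) i.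

(* a^[1/p^e]: the smallest ideal c with a contained in c^[p^e], taken as the
   intersection of all such c. *)
Definition frob_root a (e : nat) : set R :=
  \bigcap_(c in [set c : set R | is_ideal c /\ a `<=` frob_pow c e]) c.

(* a^[k/p^e] *)
Definition frac_pow a (k e : nat) : set R := frob_root (digit_pow a k) e.

(* a^[t] for t >= 0, computed with t_n = ceil(p^n t) / p^n. *)
Definition real_pow (K : realType) a (t : K) : set R :=
  \bigcup_(n : nat) frac_pow a `|Num.ceil (p%:R ^+ n * t)|%N n.

Definition lce (K : realType) a : K :=
  sup [set t : K | 0 < t /\ real_pow a t = setT].

End FrobeniusPowers.

(* Main.v *)
Require Import Defs.
From mathcomp Require Import all_boot all_order all_algebra.
From mathcomp Require Import all_classical all_reals.
From mathcomp Require Import ring lra zify.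
Set Implicit Arguments.
Unset Strict Implicit.
Unset Printing Implicit Defensive.
Import Order.TTheory GRing.Theory Num.Theory.
Local Open Scope classical_set_scope.
Local Open Scope ring_scope.

(* Suppose [k/q < lce(a) < k/(q-1)]. Since [a^[k/q]] is the whole ring, no maximal
   ideal [M] satisfies [a^[k] `<=` M^[q]]; pick [f] in [a^[k]] outside [M^[q]].
   As [k < q], base-[p] addition without carries puts
   [f^(1 + q + ... + q^(n-1))] in [a^[l_n]] with [l_n = k (q^n - 1) / (q - 1)], and
   flatness of Frobenius keeps this power outside [M^[q^n]]. Hence
   [a^[l_n / q^n]] is the whole ring, and [l_n / q^n] tends to [k/(q-1)].

   Flatness is only needed in the form [(m^[q q'] : f^q') `<=` m^[q']] for [f]
   outside [m^[q]], in a regular local ring. Krull's principal ideal theorem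
   shows that any part of a regular system of parameters [x_1, ..., x_n]
   generates a prime ideal, so that powers of the [x_i] form regular sequences
   in any order; then the socle of [A/m^[q]] is spanned by
   [(x_1 ... x_n)^(q-1)], and the colon ideals are computed on monomials. *)

(** * Ideals and localization at a prime *)

Section Ideals.
Variable A : comNzRingType.
Implicit Types (I J N P Q M S : set A) (x y z r s : A).

Lemma ideal0 I : is_ideal I -> I 0. Proof. by case. Qed.

Lemma idealD I x y : is_ideal I -> I x -> I y -> I (x + y).
Proof. by case=> _ + _; apply. Qed.

Lemma ideal_mull I r x : is_ideal I -> I x -> I (r * x).
Proof. by case=> _ _; apply. Qed.

Lemma ideal_mulr I r x : is_ideal I -> I x -> I (x * r).
Proof. by rewrite mulrC; apply: ideal_mull. Qed.

Lemma idealN I x : is_ideal I -> I x -> I (- x).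
Proof. by rewrite -mulN1r; apply: ideal_mull. Qed.

Lemma idealB I x y : is_ideal I -> I x -> I y -> I (x - y).
Proof. by move=> idI Ix Iy; apply: idealD => //; apply: idealN. Qed.

Lemma idealT : is_ideal (@setT A). Proof. by split. Qed.

Lemma ideal1_setT I : is_ideal I -> I 1 -> I = setT.
Proof.
by move=> idI I1; apply/seteqP; split=> // x _; rewrite -(mulr1 x); apply: ideal_mull.
Qed.

Lemma ideal_gen_ideal S : is_ideal (ideal_gen S).
Proof.
split=> [I [/ideal0]//|x y Ix Iy I IS|r x Ix I IS].
- by case: (IS) => idI _; apply: idealD => //; [apply: Ix|apply: Iy].
- by case: (IS) => idI _; apply: ideal_mull => //; apply: Ix.
Qed.

Lemma sub_ideal_gen S : S `<=` ideal_gen S.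
Proof. by move=> x Sx I [_]; apply. Qed.

Lemma ideal_gen_min S I : is_ideal I -> S `<=` I -> ideal_gen S `<=` I.
Proof. by move=> idI SI x; apply. Qed.

Definition ideal_add I J : set A :=
  [set z | exists x y, [/\ I x, J y & z = x + y]].

Lemma ideal_add_ideal I J : is_ideal I -> is_ideal J -> is_ideal (ideal_add I J).
Proof.
move=> idI idJ; split.
- by exists 0, 0; rewrite addr0; split=> //; apply: ideal0.
- move=> _ _ [x [y [Ix Jy ->]]] [x' [y' [Ix' Jy' ->]]].
  by exists (x + x'), (y + y'); split; [exact: idealD|exact: idealD|ring].
- move=> r _ [x [y [Ix Jy ->]]].
  by exists (r * x), (r * y); split; [exact: ideal_mull|exact: ideal_mull|ring].
Qed.

Lemma ideal_addl I J : is_ideal J -> I `<=` ideal_add I J.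
Proof. by move=> idJ x Ix; exists x, 0; rewrite addr0; split=> //; apply: ideal0. Qed.

Lemma ideal_addr I J : is_ideal I -> J `<=` ideal_add I J.
Proof. by move=> idI x Ix; exists 0, x; rewrite add0r; split=> //; apply: ideal0. Qed.

Definition ideal_princ x : set A := [set z | exists r, z = r * x].

Lemma ideal_princ_ideal x : is_ideal (ideal_princ x).
Proof.
split; first by exists 0; rewrite mul0r.
- by move=> _ _ [r ->] [s ->]; exists (r + s); rewrite mulrDl.
- by move=> r _ [s ->]; exists (r * s); rewrite mulrA.
Qed.

Lemma ideal_princ_id x : ideal_princ x x.
Proof. by exists 1; rewrite mul1r. Qed.

Definition ideal_colon I x : set A := [set r | I (r * x)].

Lemma ideal_colon_ideal I x : is_ideal I -> is_ideal (ideal_colon I x).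
Proof.
move=> idI; split; rewrite /ideal_colon /=.
- by rewrite mul0r; apply: ideal0.
- by move=> r s Ir Is; rewrite mulrDl; apply: idealD.
- by move=> r s Is; rewrite -mulrA; apply: ideal_mull.
Qed.

Lemma ideal_mul_ideal I J : is_ideal (ideal_mul I J).
Proof. exact: ideal_gen_ideal. Qed.

Lemma ideal_mul_mem I J x y : I x -> J y -> ideal_mul I J (x * y).
Proof. by move=> Ix Jy; apply: sub_ideal_gen; exists x, y. Qed.

Lemma ideal_mul_sub I J N : is_ideal N ->
  (forall x y, I x -> J y -> N (x * y)) -> ideal_mul I J `<=` N.
Proof.
by move=> idN H; apply: ideal_gen_min => // _ [x [y [Ix Jy ->]]]; apply: H.
Qed.

Lemma ideal_pow_ideal I n : is_ideal (ideal_pow I n).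
Proof. by case: n => [|n]; [exact: idealT|exact: ideal_mul_ideal]. Qed.

Lemma ideal_pow_expr I x n : I x -> ideal_pow I n (x ^+ n).
Proof.
by move=> Ix; elim: n => [//|n IH]; rewrite exprS; apply: ideal_mul_mem.
Qed.

Lemma prime_ideal_ideal P : is_prime P -> is_ideal P. Proof. by case. Qed.

Lemma prime_mulN P x y : is_prime P -> ~ P x -> ~ P y -> ~ P (x * y).
Proof. by case=> _ _ Pm Px Py /Pm[]. Qed.

Lemma prime_exprN P x n : is_prime P -> ~ P x -> ~ P (x ^+ n).
Proof.
move=> pP Px; elim: n => [|n IH]; first by case: pP.
by rewrite exprS; apply: prime_mulN.
Qed.

Lemma ideal_gen_cons x (l : seq A) z : ideal_gen [set` x :: l] z ->
  exists r w, ideal_gen [set` l] w /\ z = r * x + w.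
Proof.
have id := ideal_add_ideal (ideal_princ_ideal x) (@ideal_gen_ideal [set` l]).
move=> /(ideal_gen_min id) [].
  move=> y /=; rewrite inE => /orP[/eqP ->|yl].
    by apply: ideal_addl; [exact: ideal_gen_ideal|exact: ideal_princ_id].
  by apply: ideal_addr; [exact: ideal_princ_ideal|exact: sub_ideal_gen].
by move=> _ [w [[r ->] Hw ->]]; exists r, w.
Qed.

Lemma ideal_mul_gen_cons P x (l : seq A) z : is_ideal P ->
  ideal_mul P (ideal_gen [set` x :: l]) z ->
  exists a w, [/\ P a, ideal_mul P (ideal_gen [set` l]) w & z = a * x + w].
Proof.
move=> idP.
pose X := [set z | exists a w,
  [/\ P a, ideal_mul P (ideal_gen [set` l]) w & z = a * x + w]].
have idPl : is_ideal (ideal_mul P (ideal_gen [set` l])) by exact: ideal_mul_ideal.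
have idX : is_ideal X.
  split.
  - by exists 0, 0; rewrite mul0r addr0; split=> //; apply: ideal0.
  - move=> _ _ [a [w [Pa Hw ->]]] [b [v [Pb Hv ->]]].
    by exists (a + b), (w + v); split; [exact: idealD|exact: (idealD idPl)|ring].
  - move=> r _ [a [w [Pa Hw ->]]].
    by exists (r * a), (r * w); split; [exact: ideal_mull|exact: (ideal_mull _ idPl)|ring].
apply: (ideal_mul_sub idX) => a y Pa /ideal_gen_cons[r [w [Hw ->]]].
exists (a * r), (a * w); split; [exact: ideal_mulr|exact: ideal_mul_mem|ring].
Qed.

(** * Maximal members and associated primes in noetherian rings *)

Lemma fg_chain_union (F : set (set A)) (l : seq A) X0 : F X0 ->
  total_on F subset -> (forall x, x \in l -> exists2 X, F X & X x) ->
  exists2 X, F X & forall x, x \in l -> X x.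
Proof.
move=> FX0 totF; elim: l => [|x l IH] H; first by exists X0.
have [|X FX Xl] := IH; first by move=> y yl; apply: H; rewrite inE yl orbT.
have [Y FY Yx] := H x (mem_head _ _).
case: (totF _ _ FX FY) => [XY|YX].
- by exists Y => // y; rewrite inE => /orP[/eqP -> //|/Xl /XY].
- by exists X => // y; rewrite inE => /orP[/eqP ->|/Xl//]; exact: YX.
Qed.

(** Zorn's lemma applies because the union of a chain is finitely generated, and finitely many
    generators already lie in one member of the chain. *)
Lemma noetherian_max (F : set (set A)) : noetherian A ->
  (forall I, F I -> is_ideal I) -> F !=set0 ->
  exists2 I, F I & forall J, F J -> I `<=` J -> J = I.
Proof.
move=> noeA Fid [I0 FI0].
have [G Gsub Gtot|I [FI Imax]] := @Zorn_bigcup A [set I | I = set0 \/ F I].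
  have [[X0 [GX0 FX0]]|none] := pselect (exists X, G X /\ F X); last first.
    left; apply/seteqP; split=> // x [X GX Xx].
    have [e0|FX] := Gsub _ GX; last by case: none; exists X.
    by rewrite e0 in Xx.
  right; set U := \bigcup_(X in G) X.
  have idU : is_ideal U.
    have idG X x : G X -> X x -> is_ideal X.
      by move=> GX Xx; case: (Gsub _ GX) => [e0|/Fid//]; rewrite e0 in Xx.
    split.
    - by exists X0; [|exact: (ideal0 (Fid _ FX0))].
    - move=> x y [X GX Xx] [Y GY Yy].
      case: (Gtot _ _ GX GY) => [XY|YX].
      + by exists Y => //; apply: idealD; [exact: (idG _ _ GY Yy)|exact: (XY _ Xx)|].
      + by exists X => //; apply: idealD; [exact: (idG _ _ GX Xx)| |exact: (YX _ Yy)].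
    - move=> r x [X GX Xx]; exists X => //; apply: ideal_mull => //; exact: idG Xx.
  have [l lU] := noeA _ idU.
  have [|X GX Xl] := @fg_chain_union G l X0 GX0 Gtot.
    by move=> x xl; have : U x by rewrite lU; exact: sub_ideal_gen.
  have [X0e|FX] := Gsub _ GX.
    suff -> : U = X0 by [].
    have X0X : X0 `<=` X \/ X `<=` X0 by exact: Gtot.
    have l0 : l = [::].
      by case: l Xl {lU} => // y l /(_ y (mem_head _ _)); rewrite X0e.
    apply/seteqP; split=> [x|x X0x]; last by exists X0.
    rewrite lU l0; apply: ideal_gen_min; [exact: Fid|by []].
  suff -> : U = X by [].
  apply/seteqP; split=> [x|x Xx]; last by exists X.
  by rewrite lU; apply: ideal_gen_min; [exact: Fid|exact: Xl].
have {}FI : F I.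
  case: FI => // I0e; case: (Imax I0); last by right.
  rewrite I0e; split=> // /(_ 0); apply; exact: (ideal0 (Fid _ FI0)).
exists I => // J FJ IJ; apply: contrapT => neJI.
apply: (Imax J); last by right.
by split=> // JI; apply: neJI; apply/seteqP.
Qed.

(* Take [h] for which the annihilator of [h f] in [A/I] is maximal. *)
Lemma associated_prime I f : noetherian A -> is_ideal I -> ~ I f ->
  exists2 h, ~ I (h * f) & is_prime (ideal_colon I (h * f)).
Proof.
move=> noeA idI If.
pose F := [set K | exists2 h, ~ I (h * f) & K = ideal_colon I (h * f)].
have [||K [h Ihf ->] Kmax] := @noetherian_max F noeA.
- by move=> _ [h _ ->]; exact: ideal_colon_ideal.
- by exists (ideal_colon I f), 1; rewrite mul1r.
exists h => //; split; [exact: ideal_colon_ideal|by rewrite /ideal_colon /= mul1r|].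
move=> r s; rewrite /ideal_colon /= => Irs.
have [|Is] := pselect (I (s * (h * f))); [by right|left].
(* Multiplying by [s] can only enlarge the annihilator, so maximality forces equality, and [r] lies
   in the larger one. *)
have eIs : ideal_colon I (s * h * f) = ideal_colon I (h * f).
  apply: Kmax; first by exists (s * h); rewrite -?mulrA.
  move=> t; rewrite /ideal_colon /= => It.
  by rewrite -mulrA mulrCA; apply: ideal_mull.
suff : ideal_colon I (s * h * f) r by rewrite eIs.
by rewrite /ideal_colon /= -(mulrA s) mulrA.
Qed.

(** * Saturation at a prime and Nakayama's lemma *)

Definition saturated P I := forall s z, ~ P s -> I (s * z) -> I z.

(* The contraction to [A] of the extension of [I] to the localization at [P]. *)
Definition saturation P I : set A := [set z | exists2 s, ~ P s & I (s * z)].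

Lemma saturation_ideal P I : is_prime P -> is_ideal I -> is_ideal (saturation P I).
Proof.
move=> pP idI; have P1 : ~ P 1 by case: pP.
split.
- by exists 1 => //; rewrite mulr0; apply: ideal0.
- move=> x y [s Ps Isx] [t Pt Ity]; exists (s * t); first exact: prime_mulN.
  have -> : s * t * (x + y) = t * (s * x) + s * (t * y) by ring.
  by apply: idealD => //; apply: ideal_mull.
- by move=> r x [s Ps Isx]; exists s => //; rewrite mulrCA; apply: ideal_mull.
Qed.

Lemma saturation_saturated P I : is_prime P -> saturated P (saturation P I).
Proof.
move=> pP s z Ps [t Pt Itsz]; exists (t * s); first exact: prime_mulN.
by rewrite -mulrA.
Qed.

Lemma sub_saturation P I : is_prime P -> I `<=` saturation P I.
Proof. by case=> _ P1 _ x Ix; exists 1; rewrite ?mul1r. Qed.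

(** Generators are eliminated one at a time. A relation [t * x = n + a * x + w] with [a] in [P]
    makes [u = t - a] a denominator outside [P] with [u * x = n + w]; multiplying the relations of
    the other generators by [u] removes [x] from them. *)
Lemma nakayama_seq P N (l : seq A) : is_prime P -> is_ideal N ->
  (forall g, g \in l -> saturation P
     (ideal_add N (ideal_mul P (ideal_gen [set` l]))) g) ->
  exists2 t, ~ P t & forall g, g \in l -> N (t * g).
Proof.
move=> pP idN; have idP := prime_ideal_ideal pP.
have P1 : ~ P 1 by case: pP.
elim: l => [|x l IH] H; first by exists 1.
have [t Pt [n [_ [Nn /(ideal_mul_gen_cons idP)[a [w [Pa Hw ->]]] tx]]]] :=
  H x (mem_head _ _).
pose u := t - a.
have Pu : ~ P u by move=> Pu; apply: Pt; rewrite -(subrK a t); apply: idealD.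
have ux : u * x = n + w by rewrite mulrBl tx; ring.
have idPl : is_ideal (ideal_mul P (ideal_gen [set` l])) by exact: ideal_mul_ideal.
have [g gl|t' Pt' Ht'] := IH.
  have gxl : g \in x :: l by rewrite inE gl orbT.
  have [v Pv [n' [_ [Nn' /(ideal_mul_gen_cons idP)[a' [w' [Pa' Hw' ->]]] vg]]]] :=
    H g gxl.
  exists (u * v); first exact: prime_mulN.
  exists (u * n' + a' * n), (a' * w + u * w'); split.
  - by apply: idealD => //; apply: ideal_mull.
  - by apply: (idealD idPl); apply: (ideal_mull _ idPl).
  - by rewrite -mulrA vg !mulrDr (mulrCA u a' x) ux; ring.
exists (t' * u); first exact: prime_mulN.
have Ngen y : ideal_gen [set` l] y -> N (t' * y).
  have idc := ideal_colon_ideal t' idN.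
  move=> /(ideal_gen_min idc) Hy.
  rewrite mulrC; apply: Hy => z /= zl; rewrite /ideal_colon /= mulrC; exact: Ht'.
have Nw : N (t' * w).
  apply: Ngen; apply: (ideal_mul_sub (@ideal_gen_ideal [set` l]) _ Hw).
  by move=> y z _; apply: ideal_mull; exact: ideal_gen_ideal.
move=> g; rewrite inE => /orP[/eqP ->|gl].
  by rewrite -mulrA ux mulrDr; apply: idealD => //; apply: ideal_mull.
by rewrite mulrAC; apply: ideal_mulr => //; apply: Ht'.
Qed.

Lemma nakayama P N M : noetherian A -> is_prime P -> is_ideal N -> is_ideal M ->
  M `<=` saturation P (ideal_add N (ideal_mul P M)) ->
  exists2 t, ~ P t & forall z, M z -> N (t * z).
Proof.
move=> noeA pP idN /noeA[l ->] H.
have [g gl|t Pt Ht] := @nakayama_seq P N l pP idN.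
  by apply: H; exact: sub_ideal_gen.
exists t => // z /(ideal_gen_min (ideal_colon_ideal t idN)) Hz.
by rewrite mulrC; apply: Hz => y /= yl; rewrite /ideal_colon /= mulrC; exact: Ht.
Qed.

(** * Krull's principal ideal theorem *)

(* The quotient of [A_P] by [J] has finite length when [P] is the only prime
   between [J] and [P]: climb from [J] by adjoining elements [z] with [P z] in
   the ideal already reached. *)
Lemma saturated_dcc P J : noetherian A -> is_prime P -> is_ideal J ->
  saturated P J ->
  (forall Q, is_prime Q -> J `<=` Q -> Q `<=` P -> Q = P) ->
  forall C : nat -> set A,
  (forall i, [/\ is_ideal (C i), saturated P (C i) & J `<=` C i]) ->
  (forall i j, (i <= j)%N -> C j `<=` C i) ->
  exists n, forall i, (n <= i)%N -> C i = C n.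
Proof.
move=> noeA pP idJ satJ minP.
have idP := prime_ideal_ideal pP.
(* [dcc I] is the descending chain condition for saturated ideals between [J] and [I]. A saturated
   [I] above [J] that is maximal with this property turns out to be the whole ring. *)
pose dcc I := forall C : nat -> set A,
  (forall i, [/\ is_ideal (C i), saturated P (C i) & J `<=` C i]) ->
  (forall i, C i `<=` I) -> (forall i j, (i <= j)%N -> C j `<=` C i) ->
  exists n, forall i, (n <= i)%N -> C i = C n.
pose F := [set I | [/\ is_ideal I, saturated P I, J `<=` I & dcc I]].
have [||I [idI satI JI dccI] Imax] := @noetherian_max F noeA.
- by move=> I [].
- exists J; split=> // C HC CJ _; exists 0%N => i _.
  have eC k : C k = J by apply/seteqP; split; [exact: CJ|case: (HC k)].
  by rewrite !eC.
suff IT : I = setT by move=> C HC Cd; apply: dccI => //; rewrite IT.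
apply: ideal1_setT => //; apply: contrapT => I1.
have [z Iz pz] := @associated_prime I 1 noeA idI I1.
move: Iz pz; rewrite mulr1 => Iz pz.
(* The associated prime contains [J], and saturation of [I] keeps it inside [P], so it equals [P].
   Hence [I'] below is a simple extension of [I] at [P]. *)
have ePz : ideal_colon I z = P.
  apply: minP => //.
    by move=> x Jx; apply: ideal_mulr => //; exact: JI.
  by move=> r Irz; apply: contrapT => Pr; apply: Iz; exact: satI Irz.
have idIz : is_ideal (ideal_add I (ideal_princ z)).
  by apply: ideal_add_ideal => //; exact: ideal_princ_ideal.
pose I' := saturation P (ideal_add I (ideal_princ z)).
have II' : I `<=` I'.
  apply: subset_trans (sub_saturation pP).
  by apply: ideal_addl; exact: ideal_princ_ideal.
suff FI' : F I'.
  have eI' := Imax _ FI' II'; apply: Iz; rewrite -eI'.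
  by apply: (sub_saturation pP); apply: ideal_addr => //; exact: ideal_princ_id.
split.
- exact: saturation_ideal.
- exact: saturation_saturated.
- exact: subset_trans JI II'.
move=> C HC CI' Cd.
have [n stab] : exists n, forall i, (n <= i)%N -> C i `&` I = C n `&` I.
  apply: (dccI (fun i => C i `&` I)).
  - move=> i; have [idC satC JC] := HC i; split.
    + split; first by split; exact: ideal0.
      * by move=> x y [? ?] [? ?]; split; exact: idealD.
      * by move=> r x [? ?]; split; exact: ideal_mull.
    + by move=> s x Ps [Cx Ix]; split; [exact: satC Cx|exact: satI Ix].
    + by move=> x Jx; split; [exact: JC|exact: JI].
  - by move=> i x [].
  - by move=> i j ij x [Cx Ix]; split=> //; exact: Cd Cx.
have [[m CmI]|noCI] := pselect (exists m, C m `<=` I).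
  have eC i : (m <= i)%N -> C i = C i `&` I.
    by move=> mi; apply/esym/setIidl; apply: subset_trans CmI; exact: Cd.
  exists (maxn m n) => i; rewrite geq_max => /andP[mi ni].
  by rewrite (eC i) // (eC (maxn m n)) ?leq_maxl // stab // [RHS]stab // leq_maxr.
exists n => i ni; apply/seteqP; split; first exact: Cd.
move=> v Cv; have [idC satC JC] := HC i.
have [idCn _ _] := HC n.
(* At [P] the quotient of [I'] by [I] is a line over the residue field, spanned by any [w] outside
   [I]. Subtracting a multiple of [w] moves a multiple of [v] into [I], where the chain is already
   stable. *)
have [w Cw Iw] : exists2 w, C i w & ~ I w.
  by move: noCI => /forallNP /(_ i) /existsNP[w /not_implyP[Cw Iw]]; exists w.
have [s Ps [u [_ [Iu [r ->] sw]]]] := CI' i w Cw.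
have Pr : ~ P r.
  rewrite -ePz => Irz; apply: Iw; apply: (satI s) => //.
  by rewrite sw; apply: idealD.
have [t Pt [u' [_ [Iu' [r' ->] tv]]]] := CI' n v Cv.
apply: (satC (r * t)); first exact: prime_mulN.
have e : r * t * v - r' * s * w = r * u' - r' * u.
  by rewrite -!mulrA tv sw; ring.
have : (C n `&` I) (r * t * v - r' * s * w).
  split; last by rewrite e; apply: idealB => //; apply: ideal_mull.
  apply: idealB => //; apply: ideal_mull => //; exact: Cd Cw.
rewrite -(stab i ni) => -[Cd' _].
by rewrite -(subrK (r' * s * w) (r * t * v)); apply: idealD => //; apply: ideal_mull.
Qed.

(* Krull's principal ideal theorem in contrapositive form. If there were no
   such [Q'], the symbolic powers of [Q] modulo [O] would stabilize modulo [x]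
   at [P], hence (Nakayama) stabilize, hence (Nakayama again) vanish at [Q]. *)
Lemma exists_intermediate_prime O Q P x : noetherian A ->
  is_prime O -> is_prime Q -> is_prime P -> O `<` Q -> Q `<=` P ->
  P x -> ~ Q x ->
  exists Q', [/\ is_prime Q', O `<=` Q', Q' x & Q' `<` P].
Proof.
move=> noeA pO pQ pP [OQ QO] QP Px Qx.
apply: contrapT => noQ'.
have idO := prime_ideal_ideal pO; have idQ := prime_ideal_ideal pQ.
have idP := prime_ideal_ideal pP.
have idOx : is_ideal (ideal_add O (ideal_princ x)).
  by apply: ideal_add_ideal => //; exact: ideal_princ_ideal.
pose J := saturation P (ideal_add O (ideal_princ x)).
have minP Q' : is_prime Q' -> J `<=` Q' -> Q' `<=` P -> Q' = P.
  move=> pQ' JQ' Q'P; apply/seteqP; split=> // y Py; apply: contrapT => Q'y.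
  apply: noQ'; exists Q'; split=> //.
  - move=> z Oz; apply: JQ'; apply: sub_saturation => //.
    by apply: ideal_addl => //; exact: ideal_princ_ideal.
  - apply: JQ'; apply: sub_saturation => //.
    by apply: ideal_addr => //; exact: ideal_princ_id.
  - by split=> // /(_ y Py).
pose S n := saturation Q (ideal_add O (ideal_pow Q n)).
have idOQ n : is_ideal (ideal_add O (ideal_pow Q n)).
  by apply: ideal_add_ideal => //; exact: ideal_pow_ideal.
have idS n : is_ideal (S n) by exact: saturation_ideal.
have OS n : O `<=` S n.
  move=> z Oz; apply: sub_saturation => //.
  by apply: ideal_addl => //; exact: ideal_pow_ideal.
have powS n : ideal_pow Q n.+1 `<=` ideal_pow Q n.
  apply: ideal_mul_sub; first exact: ideal_pow_ideal.
  by move=> y z _; apply: ideal_mull; exact: ideal_pow_ideal.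
have SS n : S n.+1 `<=` S n.
  move=> z [s Qs [u [v [Ou /powS Hv e]]]].
  by exists s => //; exists u, v.
have Sd i j : (i <= j)%N -> S j `<=` S i.
  move=> /subnK <-; elim: (j - i)%N => [//|k IH].
  by apply: subset_trans IH; exact: SS.
have satS n : saturated Q (S n) by exact: saturation_saturated.
have idSx n : is_ideal (ideal_add (S n) (ideal_princ x)).
  by apply: ideal_add_ideal => //; exact: ideal_princ_ideal.
pose C n := saturation P (ideal_add (S n) (ideal_princ x)).
have [n stab] : exists n, forall i, (n <= i)%N -> C i = C n.
  apply: (saturated_dcc noeA pP _ _ minP); first exact: saturation_ideal.
  - exact: saturation_saturated.
  - move=> i; split; [exact: saturation_ideal|exact: saturation_saturated|].
    move=> z [s Ps [u [v [Ou Hv e]]]]; exists s => //.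
    by exists u, v; split=> //; exact: OS.
  - move=> i j ij z [s Ps [u [v [Su Hv e]]]]; exists s => //.
    by exists u, v; split=> //; exact: Sd Su.
(* Stability gives [s * z = w + r * x] with [w] in [S n.+1]. Then [r * x] is in [S n], hence so is
   [r], because [x] is outside [Q]. Thus [S n] lies in [S n.+1 + P * S n] at [P]. *)
have [s Ps sS] : exists2 s, ~ P s & forall z, S n z -> S n.+1 (s * z).
  apply: nakayama => // z Sz.
  have : C n.+1 z.
    rewrite stab //; apply: sub_saturation => //.
    by apply: ideal_addl => //; exact: ideal_princ_ideal.
  move=> [s Ps [w [_ [Sw [r ->] e]]]]; exists s => //.
  exists w, (r * x); split=> //; rewrite mulrC; apply: ideal_mul_mem => //.
  apply: (satS n x) => //; rewrite mulrC.
  have -> : r * x = s * z - w by rewrite e; ring.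
  by apply: idealB => //; [exact: ideal_mull|exact: SS].
have {}sS z : S n z -> S n.+1 z.
  by move=> /sS; apply: satS => Qs; apply: Ps; exact: QP.
(* Equality of consecutive symbolic powers says that [Q^n] lies in [O + Q * Q^n] at [Q], so a
   multiplier outside [Q] sends [Q^n] into [O]. A power of an element of [Q] outside [O] then
   contradicts primality of [O]. *)
have [t Qt tQ] : exists2 t, ~ Q t & forall z, ideal_pow Q n z -> O (t * z).
  apply: nakayama => //; first exact: ideal_pow_ideal.
  move=> z Hz; apply: sS; apply: sub_saturation => //.
  by apply: ideal_addr.
move: QO => /existsNP[y /not_implyP[Qy Oy]].
have : O (t * y ^+ n) by apply: tQ; exact: ideal_pow_expr.
apply: prime_mulN => //; last exact: prime_exprN.
by move=> /OQ.
Qed.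

(** A lower bound [d] on the coheight of [Q]. Recursing from the bottom suits inductions that
    replace [Q] by a larger prime. *)
Fixpoint chain_above (d : nat) Q : Prop :=
  if d is d'.+1 then is_prime Q /\ exists Q', Q `<` Q' /\ chain_above d' Q'
  else is_prime Q.

Lemma chain_above_prime (d : nat) Q : chain_above d Q -> is_prime Q.
Proof. by case: d => [|d] //= []. Qed.

Lemma chain_above_prime_chain (d : nat) (P : nat -> set A) :
  (forall i, (i <= d)%N -> is_prime (P i)) ->
  (forall i, (i < d)%N -> P i `<` P i.+1) -> chain_above d (P 0%N).
Proof.
elim: d P => [|d IH] P pP ltP /=; first exact: pP.
split; first exact: pP.
exists (P 1%N); split; first exact: ltP.
by apply: (IH (fun i => P i.+1)) => i ir; [exact: pP|exact: ltP].
Qed.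

(** Imposing one more equation costs at most one step of the chain: [x] belongs to [m] and is pushed
    down one prime at a time by [exists_intermediate_prime]. *)
Lemma chain_above_mem m (d : nat) Q x : noetherian A -> is_prime m ->
  (forall P, is_prime P -> P `<=` m) -> m x -> chain_above d.+1 Q ->
  exists Q', [/\ Q `<=` Q', Q' x & chain_above d Q'].
Proof.
move=> noeA pm subm mx; elim: d Q => [|d IH] Q [pQ [Q1 [ltQ chQ1]]].
  by exists m; split=> //; exact: subm.
have {}chQ1 : chain_above d.+1 Q1 := chQ1.
have [Q1x|Q1x] := pselect (Q1 x).
  by exists Q1; split=> //; exact: properW.
have [Q2 [Q12 Q2x chQ2]] := IH _ chQ1.
have [Q' [pQ' QQ' Q'x ltQ']] := exists_intermediate_prime noeA pQ
  (chain_above_prime chQ1) (chain_above_prime chQ2) ltQ Q12 Q2x Q1x.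
by exists Q'; split=> //; split=> //; exists Q2.
Qed.

Lemma chain_above_trunc (d : nat) Q : chain_above d.+1 Q -> chain_above d Q.
Proof.
elim: d Q => [|d IH] Q; first by case.
by case=> pQ [Q' [ltQ ch]]; split=> //; exists Q'; split=> //; exact: IH.
Qed.

End Ideals.

(** * Regular systems of parameters *)

Lemma exprDn_frob (A : comNzRingType) (p e : nat) (x y : A) : p \in [pchar A] ->
  (x + y) ^+ (p ^ e) = x ^+ (p ^ e) + y ^+ (p ^ e).
Proof.
by move=> charp; rewrite exprDn_pchar // pnatX pnatE ?charp ?(pcharf_prime charp).
Qed.

Section RegularLocal.
Variable A : comNzRingType.
Implicit Types (I J N P Q M S : set A) (x y z r s : A).

Lemma ideal_gen_eqi (l l' : seq A) : l =i l' -> ideal_gen [set` l] = ideal_gen [set` l'].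
Proof. by move=> e; congr ideal_gen; apply/seteqP; split=> y /=; rewrite e. Qed.

(* [Q] is squeezed between [(l1)] and a prime that equals [(l1, x)] by induction,
   and does not contain [x] for want of room in the chain; so [Q = (l1) + x Q]. *)
Lemma regular_local_cat m (l1 l2 : seq A) Q : noetherian A -> is_prime m ->
  (forall P, is_prime P -> P `<=` m) ->
  (forall t, ~ m t -> exists s, s * t = 1) ->
  m = ideal_gen [set` l1 ++ l2] -> ideal_gen [set` l1] `<=` Q ->
  chain_above (size l2) Q ->
  Q = ideal_gen [set` l1] /\ forall x l, l2 = x :: l -> ~ Q x.
Proof.
move=> noeA pm subm unitm.
elim: l2 l1 Q => [|x l2 IH] l1 Q em l1Q chQ.
  split=> //; apply/seteqP; split=> //.
  by rewrite cats0 in em; rewrite -em; by apply: subm; exact: chain_above_prime chQ.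
have {}em : m = ideal_gen [set` (x :: l1) ++ l2].
  by rewrite em; apply: ideal_gen_eqi => y; rewrite !(mem_cat, inE) -?orbA orbCA.
have pQ := chain_above_prime chQ; have idQ := prime_ideal_ideal pQ.
have mx : m x by rewrite em; apply: sub_ideal_gen => /=; rewrite mem_head.
have cons_sub Q' : is_ideal Q' -> Q' x -> ideal_gen [set` l1] `<=` Q' ->
    ideal_gen [set` x :: l1] `<=` Q'.
  move=> idQ' Q'x l1Q'; apply: ideal_gen_min => // y /=.
  rewrite inE => /orP[/eqP -> //|yl]; apply: l1Q'.
  exact: sub_ideal_gen.
(* If [x] were in [Q], induction would identify both [Q] and the next prime of the chain with the
   ideal of [x :: l1], against strictness. *)
have Qx : ~ Q x.
  move=> Qx; have [_ [Q1 [ltQ chQ1]]] := chQ.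
  have [eQ _] := IH _ _ em (cons_sub _ idQ Qx l1Q) (chain_above_trunc chQ).
  have QQ1 := properW ltQ.
  have [eQ1 _] := IH _ _ em (cons_sub _ (prime_ideal_ideal (chain_above_prime chQ1))
    (QQ1 _ Qx) (subset_trans l1Q QQ1)) chQ1.
  by rewrite eQ eQ1 in ltQ; exact: properxx ltQ.
split; last by move=> _ _ [<- _].
have [Q' [QQ' Q'x chQ']] := chain_above_mem noeA pm subm mx chQ.
have [eQ' _] := IH _ _ em (cons_sub _ (prime_ideal_ideal (chain_above_prime chQ'))
    Q'x (subset_trans l1Q QQ')) chQ'.
have idl1 : is_ideal (ideal_gen [set` l1]) by exact: ideal_gen_ideal.
apply/seteqP; split=> //.
have [t mt tQ] : exists2 t, ~ m t & forall z, Q z -> ideal_gen [set` l1] (t * z).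
  apply: nakayama => // z Qz; apply: sub_saturation => //.
  move: (QQ' _ Qz); rewrite eQ' => /ideal_gen_cons[r [w [Hw e]]].
  exists w, (x * r); split; [by []| |by rewrite e; ring].
  apply: ideal_mul_mem => //; case: pQ => _ _ Qm.
  have [//|//] : Q r \/ Q x.
  apply: Qm; have -> : r * x = z - w by rewrite e; ring.
  by apply: idealB => //; exact: l1Q.
have [s st] := unitm _ mt.
move=> z Qz; rewrite -(mul1r z) -st -mulrA; apply: (ideal_mull _ idl1); exact: tQ.
Qed.

Lemma chain_above_seq m (l : seq A) (d : nat) Q : noetherian A -> is_prime m ->
  (forall P, is_prime P -> P `<=` m) ->
  (forall y, y \in l -> m y) -> chain_above (size l + d) Q ->
  exists Q', [/\ Q `<=` Q', forall y, y \in l -> Q' y & chain_above d Q'].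
Proof.
move=> noeA pm subm; elim: l Q => [|x l IH] Q ml chQ; first by exists Q; split.
have [Q1 [QQ1 Q1x chQ1]] :=
  chain_above_mem noeA pm subm (ml x (mem_head _ _)) chQ.
have [|Q' [Q1Q' Q'l chQ']] := IH Q1 _ chQ1.
  by move=> y yl; apply: ml; rewrite inE yl orbT.
exists Q'; split=> //; first exact: subset_trans Q1Q'.
by move=> y; rewrite inE => /orP[/eqP ->|/Q'l//]; exact: Q1Q'.
Qed.

(** * Ideals generated by powers of parameters *)

Section RegularSystem.
Variables (m : set A) (n : nat) (x : 'I_n -> A).
Implicit Types (T : {set 'I_n}) (a b : 'I_n -> nat) (i j : 'I_n).
Hypothesis noeA : noetherian A.
Hypothesis pm : is_prime m.
Hypothesis subm : forall P, is_prime P -> P `<=` m.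
Hypothesis unitm : forall t, ~ m t -> exists s, s * t = 1.
Hypothesis em : m = ideal_gen (range x).

(** Exponents depend on the index because the colon computations change them one parameter at a
    time. Frobenius powers of [m] are the case of full [T] and constant exponent, see
    [frob_pow_maximal]. *)
Definition pow_ideal (T : {set 'I_n}) (a : 'I_n -> nat) : set A :=
  ideal_gen [set z | exists2 i, i \in T & z = x i ^+ a i].


Lemma pow_ideal_ideal T a : is_ideal (pow_ideal T a).
Proof. exact: ideal_gen_ideal. Qed.

Lemma pow_ideal_mem T a i c : i \in T -> (a i <= c)%N -> pow_ideal T a (x i ^+ c).
Proof.
move=> iT /subnK <-; rewrite exprD; apply: (ideal_mull _ (pow_ideal_ideal _ _)).
by apply: sub_ideal_gen; exists i.
Qed.

Lemma pow_ideal_sub T T' a b : T \subset T' -> (forall i, i \in T -> (b i <= a i)%N) ->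
  pow_ideal T a `<=` pow_ideal T' b.
Proof.
move=> /fintype.subsetP TT' ba; apply: ideal_gen_min; first exact: pow_ideal_ideal.
by move=> _ [i iT ->]; apply: pow_ideal_mem; [exact: TT'|exact: ba].
Qed.

Lemma pow_idealP T a i z : i \in T -> pow_ideal T a z ->
  exists c w, pow_ideal (T :\ i) a w /\ z = c * x i ^+ a i + w.
Proof.
move=> iT.
have id := ideal_add_ideal (ideal_princ_ideal (x i ^+ a i)) (pow_ideal_ideal (T :\ i) a).
move=> /(ideal_gen_min id) [|_ [w [[c ->] Hw ->]]]; last by exists c, w.
move=> _ [j jT ->]; have [->|ji] := eqVneq j i.
  by apply: ideal_addl; [exact: pow_ideal_ideal|exact: ideal_princ_id].
apply: ideal_addr; first exact: ideal_princ_ideal.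
by apply: pow_ideal_mem; rewrite // in_setD1 ji.
Qed.

Variable Q0 : set A.
Hypothesis chQ0 : chain_above n Q0.

(** The parameters are listed as those in [T], then [x i], then the rest. Passing to a prime
    containing the first group leaves a chain long enough for [regular_local_cat]. *)
Lemma prime_pow_ideal (T : {set 'I_n}) i (a : 'I_n -> nat) : i \notin T ->
  (forall j, j \in T -> a j = 1%N) ->
  is_prime (pow_ideal T a) /\ ~ pow_ideal T a (x i).
Proof.
move=> iT a1.
pose l1 := [seq x j | j in T]; pose l2 := [seq x j | j in ~: T :\ i].
have sz : n = (size l1 + (size l2).+1)%N.
  rewrite !size_image -{1}(card_ord n) -(cardsC T) (cardsD1 i (~: T)).
  by rewrite inE iT add1n.
have eT : pow_ideal T a = ideal_gen [set` l1].
  congr ideal_gen; apply/seteqP; split=> z /=.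
    by move=> [j jT ->]; rewrite a1 // expr1; apply/fintype.imageP; exists j.
  by move=> /fintype.imageP[j jT ->]; exists j; rewrite ?a1.
have el : m = ideal_gen [set` l1 ++ x i :: l2].
  rewrite em; congr ideal_gen; apply/seteqP; split=> z /=.
    move=> [j _ <-]; rewrite mem_cat inE.
    apply/or3P; have [jT|jT] := boolP (j \in T).
      by constructor 1; apply/fintype.imageP; exists j.
    have [->|ji] := eqVneq j i; first by constructor 2.
    by constructor 3; apply/fintype.imageP; exists j; rewrite // !inE ji.
  by rewrite mem_cat inE => /or3P[/fintype.imageP[j _ ->]|/eqP ->|/fintype.imageP[j _ ->]]; eexists.
have ml1 y : y \in l1 -> m y.
  by move=> yl; rewrite el; apply: sub_ideal_gen => /=; rewrite mem_cat yl.
have := chQ0; rewrite [X in chain_above X]sz => chQ0'.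
have [Q [_ l1Q chQ]] := chain_above_seq noeA pm subm ml1 chQ0'.
have l1Q' : ideal_gen [set` l1] `<=` Q.
  by apply: ideal_gen_min => //; exact/prime_ideal_ideal/chain_above_prime/chQ.
have [eQ Qx] := regular_local_cat (l2 := x i :: l2) noeA pm subm unitm el l1Q' chQ.
rewrite eT -eQ; split; first exact: chain_above_prime chQ.
exact: Qx.
Qed.

Lemma pow_ideal_eqa T a b : {in T, a =1 b} -> pow_ideal T a = pow_ideal T b.
Proof.
move=> ab; congr ideal_gen; apply/seteqP; split=> _ [i iT ->]; exists i => //.
  by rewrite ab.
by rewrite ab.
Qed.

(** Induction on the sum of the exponents. When all are 1 the ideal is prime and misses [x i].
    Otherwise some [a j] exceeds 1: with it lowered by one, induction gives
    [z = c * x j ^+ (a j).-1 + u], and [c] is then shown to be divisible by [x j] modulo the other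
    powers. *)
Lemma pow_ideal_regular T a i z : i \notin T -> (forall j, j \in T -> (0 < a j)%N) ->
  pow_ideal T a (x i * z) -> pow_ideal T a z.
Proof.
have [k] := ubnP (\sum_(j in T) a j).
elim: k T a i z => // k IH T a i z; rewrite ltnS => le_k iT a_gt0 Hz.
have [/existsP[j /andP[jT aj]]|no] := boolP [exists j, (j \in T) && (1 < a j)%N]; last first.
  have a1 j : j \in T -> a j = 1%N.
    move=> jT; apply/eqP; rewrite eqn_leq a_gt0 // andbT leqNgt.
    by apply: contra no => aj; apply/existsP; exists j; rewrite jT.
  have [[_ _ pT] Tx] := prime_pow_ideal iT a1.
  by case: (pT _ _ Hz).
pose upd (b : nat) := fun l => if l == j then b else a l.
have updE (b : nat) : pow_ideal (T :\ j) (upd b) = pow_ideal (T :\ j) a.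
  by apply: pow_ideal_eqa => l; rewrite in_setD1 /upd => /andP[/negPf->].
have upd_sum (b : nat) : (b < a j)%N -> (\sum_(l in T) upd b l < k)%N.
  move=> ba; apply: leq_trans le_k.
  rewrite (bigD1 j) //= [X in (_ < X)%N](bigD1 j) //= /upd eqxx -addSn leq_add //.
  by apply: leq_sum => l /andP[_ /negPf ->].
have upd_gt0 (b : nat) : (0 < b)%N -> forall l, l \in T -> (0 < upd b l)%N.
  by move=> b0 l lT; rewrite /upd; case: eqP => // _; exact: a_gt0.
have sub_upd (b : nat) : (b <= a j)%N -> pow_ideal T a `<=` pow_ideal T (upd b).
  move=> ba; apply: pow_ideal_sub => // l _; rewrite /upd.
  by case: eqP => // ->.
have aj1 : ((a j).-1 < a j)%N by rewrite ltn_predL; lia.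
have Hz1 : pow_ideal T (upd (a j).-1) z.
  apply: (IH _ _ i) => //; [exact: upd_sum|by apply: upd_gt0; lia|].
  by apply: (sub_upd _ (ltnW aj1)).
have [c [u [Hu ez]]] := pow_idealP jT Hz1.
rewrite {1}/upd eqxx updE in ez Hu.
have [d [v [Hv exz]]] := pow_idealP jT Hz.
have idTj := pow_ideal_ideal (T :\ j) a.
(* The two expressions for [x i * z] are compared modulo the powers indexed by [T :\ j], where
   induction allows cancelling [x j ^+ (a j).-1]. *)
have Hj : pow_ideal (T :\ j) a (x i * c - d * x j).
  have reg w : pow_ideal (T :\ j) a (x j * w) -> pow_ideal (T :\ j) a w.
    apply: IH; rewrite ?in_setD1 ?eqxx //.
      apply: leq_trans le_k; rewrite [X in (_ < X)%N](bigD1 j) //=.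
      rewrite (eq_bigl (fun l => (l \in T) && (l != j))).
        by rewrite -[X in (X < _)%N]add0n ltn_add2r; lia.
      by move=> l; rewrite in_setD1 andbC.
    by move=> l; rewrite in_setD1 => /andP[_ lT]; exact: a_gt0.
  have regX (b : nat) w : pow_ideal (T :\ j) a (x j ^+ b * w) -> pow_ideal (T :\ j) a w.
    by elim: b => [|b IHb]; rewrite ?mul1r // exprS -mulrA => /reg.
  apply: (regX (a j).-1).
  have -> : x j ^+ (a j).-1 * (x i * c - d * x j) = v - x i * u.
    have e : x j ^+ a j = x j * x j ^+ (a j).-1 by rewrite -exprS prednK //; lia.
    have e1 : x i * (c * x j ^+ (a j).-1 + u) = d * (x j * x j ^+ (a j).-1) + v.
      by rewrite -ez exz e.
    have -> : v = x i * (c * x j ^+ (a j).-1 + u) - d * (x j * x j ^+ (a j).-1).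
      by rewrite e1; ring.
    ring.
  by apply: (idealB idTj) => //; exact: (ideal_mull _ idTj).
have Hc : pow_ideal T (upd 1%N) c.
  apply: (IH _ _ i) => //; [exact: upd_sum|exact: upd_gt0|].
  have -> : x i * c = d * x j + (x i * c - d * x j) by ring.
  apply: (idealD (pow_ideal_ideal _ _)).
    apply: (ideal_mull _ (pow_ideal_ideal _ _)); rewrite -[x j]expr1.
    by apply: pow_ideal_mem => //; rewrite /upd eqxx.
  rewrite -(updE 1%N) in Hj.
  by apply: pow_ideal_sub Hj => //; rewrite subD1set.
have [c' [u' [Hu' ec]]] := pow_idealP jT Hc.
rewrite {1}/upd eqxx updE expr1 in ec Hu'.
have sTj : pow_ideal (T :\ j) a `<=` pow_ideal T a.
  by apply: pow_ideal_sub => //; rewrite subD1set.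
have -> : z = c' * x j ^+ a j + (x j ^+ (a j).-1 * u' + u).
  have -> : x j ^+ a j = x j * x j ^+ (a j).-1 by rewrite -exprS prednK //; lia.
  by rewrite ez ec; ring.
have idT := pow_ideal_ideal T a.
apply: (idealD idT); first by apply: (ideal_mull _ idT); apply: pow_ideal_mem.
by apply: (idealD idT); [apply: (ideal_mull _ idT)|]; exact: sTj.
Qed.

Lemma pow_ideal_regularX T a i (c : nat) z : i \notin T ->
  (forall j, j \in T -> (0 < a j)%N) ->
  pow_ideal T a (x i ^+ c * z) -> pow_ideal T a z.
Proof.
move=> iT a_gt0; elim: c => [|c IH]; first by rewrite mul1r.
by rewrite exprS -mulrA => /(pow_ideal_regular iT a_gt0).
Qed.

(** After subtracting a multiple of [x i ^+ a i] from [z], the factor [x i ^+ c] can be cancelled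
    modulo the other powers. The exponent at [i] may be 0, as in [pow_ideal_socle] with [q = 1]. *)
Lemma pow_ideal_colon T a i (c : nat) z : i \in T ->
  (forall j, j \in T -> j != i -> (0 < a j)%N) ->
  pow_ideal T (fun j => if j == i then (a j + c)%N else a j) (x i ^+ c * z) ->
  pow_ideal T a z.
Proof.
move=> iT a_gt0 /(pow_idealP iT)[d [w []]]; rewrite eqxx.
rewrite (pow_ideal_eqa (b := a)) => [Hw e|j]; last first.
  by rewrite in_setD1 => /andP[/negPf->].
have : pow_ideal (T :\ i) a (z - d * x i ^+ a i).
  apply: (pow_ideal_regularX (i := i) (c := c)); first by rewrite in_setD1 eqxx.
    by move=> j; rewrite in_setD1 => /andP[ji jT]; exact: a_gt0.
  suff -> : x i ^+ c * (z - d * x i ^+ a i) = w by [].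
  by rewrite mulrBr e exprD; ring.
move=> /(pow_ideal_sub (subD1set T i) (fun j _ => leqnn (a j))) Hz.
rewrite -(subrK (d * x i ^+ a i) z); apply: (idealD (pow_ideal_ideal _ _)) => //.
by apply: (ideal_mull _ (pow_ideal_ideal _ _)); apply: pow_ideal_mem.
Qed.

Lemma pow_ideal_colon_prod T a (s : seq 'I_n) (c : nat) z : uniq s ->
  {subset s <= T} -> (forall j, j \in T -> (0 < a j)%N) ->
  pow_ideal T (fun j => if j \in s then (a j + c)%N else a j)
    (\prod_(i <- s) x i ^+ c * z) ->
  pow_ideal T a z.
Proof.
elim: s => [|i s IH] /=; first by rewrite big_nil mul1r.
move=> /andP[is_ us] sT a_gt0; rewrite big_cons -mulrA => H.
apply: IH => //; first by move=> j js; apply: sT; rewrite inE js orbT.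
apply: (pow_ideal_colon (i := i) (c := c)).
- by apply: sT; rewrite mem_head.
- by move=> j jT _; case: ifP => _; rewrite ?ltn_addr ?a_gt0.
move: H; congr (pow_ideal _ _ _); apply/funext => j; rewrite inE.
by case: eqP => [->|]; rewrite ?(negPf is_).
Qed.

(* The socle of [A / (x_i ^ q)_i] is spanned by [(prod_i x_i) ^ (q - 1)]. *)
Lemma pow_ideal_socle (q : nat) g (s : seq 'I_n) : (0 < q)%N -> uniq s ->
  (forall i, pow_ideal [set: 'I_n] (fun=> q) (x i * g)) ->
  ideal_add (pow_ideal [set: 'I_n] (fun=> q))
    (ideal_princ (\prod_(i <- s) x i ^+ q.-1)) g.
Proof.
move=> q_gt0 + Hg; set I := pow_ideal _ _.
have idI : is_ideal I by exact: pow_ideal_ideal.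
elim: s => [|i s IH] /=.
  move=> _; apply: ideal_addr => //; rewrite big_nil.
  by exists g; rewrite mulr1.
move=> /andP[is_ us]; have [u [_ [Iu [h ->] eg]]] := IH us.
(* Cancelling the product over [s] lowers the exponents there from [q] to 1. Cancelling [x i] from
   [x i * h] then leaves exponent [q.-1] at [i], which supplies the next factor of the product. *)
pose a j := if j \in s then 1%N else q.
have Hxh : pow_ideal [set: 'I_n] a (x i * h).
  apply: (pow_ideal_colon_prod (s := s) (c := q.-1)) => //.
  - by move=> j; rewrite inE.
  - by move=> j _; rewrite /a; case: ifP.
  have -> : \prod_(j <- s) x j ^+ q.-1 * (x i * h) = x i * g - x i * u.
    by rewrite eg; ring.
  rewrite (pow_ideal_eqa (b := fun=> q)).
    by apply: (idealB idI); [exact: Hg|exact: (ideal_mull _ idI)].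
  by move=> j _; rewrite /a /=; case: (j \in s); rewrite // add1n prednK.
pose b j := if j == i then q.-1 else a j.
have Hh : pow_ideal [set: 'I_n] b h.
  apply: (pow_ideal_colon (i := i) (c := 1%N)); first by rewrite inE.
    by move=> j _ /negPf ji; rewrite /b ji /a; case: ifP.
  rewrite expr1; move: Hxh; congr (pow_ideal _ _ _); apply/funext => j.
  rewrite /b; case: eqP => [->|//].
  by rewrite /a (negPf is_) addn1 prednK.
rewrite big_cons; set X := \prod_(j <- s) _.
have idadd : is_ideal (ideal_add I (ideal_princ (x i ^+ q.-1 * X))).
  by apply: ideal_add_ideal => //; exact: ideal_princ_ideal.
rewrite eg; apply: (idealD idadd) => //.
  by apply: ideal_addl => //; exact: ideal_princ_ideal.
apply: (ideal_gen_min (ideal_colon_ideal _ idadd) _ Hh).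
move=> _ [j _ ->]; rewrite /ideal_colon /= /b.
case: eqP => [->|ji]; first by apply: ideal_addr => //; exact: ideal_princ_id.
apply: ideal_addl; first exact: ideal_princ_ideal.
(* For [j] in [s] the generator [x j] completes the factor [x j ^+ q.-1] of [X] to [x j ^+ q]. *)
rewrite /a; case: ifP => js; last first.
  by apply: (ideal_mulr _ idI) => //; apply: pow_ideal_mem; rewrite ?inE.
rewrite /X (big_rem j) //= mulrA -exprD add1n prednK //.
by apply: (ideal_mulr _ idI) => //; apply: pow_ideal_mem; rewrite ?inE.
Qed.

(* Flatness of Frobenius: [(m^[q q'] : f^q')] is contained in
   [(m^[q] : f)^[q'] `<=` m^[q']]. *)
Lemma pow_ideal_flat (p e d : nat) f g : p \in [pchar A] ->
  ~ pow_ideal [set: 'I_n] (fun=> p ^ e)%N f ->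
  pow_ideal [set: 'I_n] (fun=> p ^ (e + d))%N (f ^+ (p ^ d) * g) ->
  pow_ideal [set: 'I_n] (fun=> p ^ d)%N g.
Proof.
move=> charp If Hfg; have p_gt0 : (0 < p)%N by exact/prime_gt0/(pcharf_prime charp).
set q := (p ^ e)%N in If *; set q' := (p ^ d)%N in Hfg *.
have q_gt0 : (0 < q)%N by rewrite expn_gt0 p_gt0.
have q'_gt0 : (0 < q')%N by rewrite expn_gt0 p_gt0.
have frobD (y z : A) := exprDn_frob d y z charp.
set I := pow_ideal _ _ in If.
have idI : is_ideal I by exact: pow_ideal_ideal.
have [h Ihf pI] := associated_prime noeA idI If.
(* The associated prime contains [x i ^+ q], hence [x i]; so [h * f] represents a socle element. *)
have Hx i : I (x i * (h * f)).
  suff : ideal_colon I (h * f) (x i) by [].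
  apply: contrapT => /(prime_exprN (n := q) pI); apply.
  by apply: (ideal_mulr _ idI) => //; apply: pow_ideal_mem; rewrite ?inE.
have := pow_ideal_socle q_gt0 (enum_uniq 'I_n) Hx.
rewrite -/I => -[u [_ [Iu [v ->] ehf]]].
(* Every parameter kills the socle generator modulo [I], so [v] in [m] would put [h * f] in [I]. *)
have mv : ~ m v.
  rewrite em => mv; apply: Ihf; rewrite ehf; apply: (idealD idI) => //.
  apply: (ideal_gen_min (ideal_colon_ideal _ idI) _ mv) => _ [i _ <-].
  rewrite /ideal_colon /= (big_rem i) ?mem_enum //= mulrA -exprS prednK //.
  by apply: (ideal_mulr _ idI) => //; apply: pow_ideal_mem; rewrite ?inE.
have [w wv] := unitm mv.
set J := pow_ideal _ _ in Hfg; have idJ : is_ideal J by exact: pow_ideal_ideal.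
have Ju : J (u ^+ q').
  have idc : is_ideal [set y | J (y ^+ q')].
    split=> /=.
    - by rewrite expr0n eqn0Ngt q'_gt0; exact: ideal0.
    - by move=> y z Jy Jz; rewrite frobD; exact: (idealD idJ).
    - by move=> r y Jy; rewrite exprMn; exact: (ideal_mull _ idJ).
  apply: (ideal_gen_min idc _ Iu) => _ [i _ ->] /=.
  by rewrite -exprM -expnD; apply: pow_ideal_mem; rewrite ?inE.
(* The exponents match because [q' + (q - 1) * q' = q * q']. *)
apply: (pow_ideal_colon_prod (s := enum 'I_n) (c := (q.-1 * q')%N)) => //.
- exact: enum_uniq.
- by move=> i; rewrite inE.
rewrite (pow_ideal_eqa (b := fun=> (p ^ (e + d))%N)); last first.
  by move=> j _; rewrite mem_enum -mulSn prednK // -expnD.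
rewrite -/J.
have -> : g = w ^+ q' * v ^+ q' * g by rewrite -exprMn wv expr1n mul1r.
have -> : \prod_(i <- enum 'I_n) x i ^+ (q.-1 * q') =
    (\prod_(i <- enum 'I_n) x i ^+ q.-1) ^+ q'.
  by rewrite -prodrXl; apply: eq_bigr => i _; rewrite exprM.
have -> : (\prod_(i <- enum 'I_n) x i ^+ q.-1) ^+ q' * (w ^+ q' * v ^+ q' * g) =
    w ^+ q' * ((h * f) ^+ q' * g - u ^+ q' * g).
  by rewrite ehf frobD exprMn; ring.
apply: (ideal_mull _ idJ) => //; apply: (idealB idJ) => //; last exact: (ideal_mulr _ idJ).
by rewrite exprMn -mulrA; exact: (ideal_mull _ idJ).
Qed.

Lemma frob_pow_maximal (p e : nat) : p \in [pchar A] ->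
  frob_pow p m e = pow_ideal [set: 'I_n] (fun=> p ^ e)%N.
Proof.
move=> charp; have p_gt0 : (0 < p)%N by exact/prime_gt0/(pcharf_prime charp).
apply/seteqP; split; apply: ideal_gen_min => //; try exact: ideal_gen_ideal.
  move=> _ [y0 my0 <-]; rewrite em in my0.
  have idc : is_ideal [set y | pow_ideal [set: 'I_n] (fun=> p ^ e)%N (y ^+ (p ^ e))].
    split=> /=.
    - by rewrite expr0n eqn0Ngt expn_gt0 p_gt0; exact: (ideal0 (pow_ideal_ideal _ _)).
    - move=> y z Jy Jz; rewrite exprDn_frob //; exact: (idealD (pow_ideal_ideal _ _)).
    - by move=> r y Jy; rewrite exprMn; exact: (ideal_mull _ (pow_ideal_ideal _ _)).
  apply: (ideal_gen_min idc _ my0) => _ [i _ <-] /=.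
  by apply: pow_ideal_mem; rewrite ?inE.
move=> _ [i _ ->]; apply: sub_ideal_gen; exists (x i) => //.
by rewrite em; apply: sub_ideal_gen; exists i.
Qed.

End RegularSystem.

End RegularLocal.

(** * Flatness of Frobenius at maximal ideals *)

Section MaximalIdeals.
Variable A : comNzRingType.
Implicit Types (I M : set A).

Lemma exists_maximal I : noetherian A -> is_ideal I -> ~ I 1 ->
  exists2 M, is_maximal M & I `<=` M.
Proof.
move=> noeA idI I1.
pose F := [set J | [/\ is_ideal J, I `<=` J & ~ J 1]].
have [||M [idM IM M1] Mmax] := @noetherian_max A F noeA.
- by move=> J [].
- by exists I; split.
exists M => //; split=> // J idJ MJ J1; apply: Mmax => //.
by split=> //; exact: subset_trans MJ.
Qed.

Lemma maximal_comax M t : is_maximal M -> ~ M t ->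
  exists r u, M u /\ 1 = r * t + u.
Proof.
move=> [idM M1 Mmax] Mt; apply: contrapT => no.
have idMt : is_ideal (ideal_add M (ideal_princ t)).
  by apply: ideal_add_ideal => //; exact: ideal_princ_ideal.
apply: Mt; rewrite -(Mmax _ idMt).
- by apply: ideal_addr => //; exact: ideal_princ_id.
- by apply: ideal_addl; exact: ideal_princ_ideal.
- by move=> [u [_ [Mu [r ->] e]]]; apply: no; exists r, u; rewrite addrC.
Qed.

Lemma maximal_prime M : is_maximal M -> is_prime M.
Proof.
move=> maxM; have [idM M1 _] := maxM; split=> // x y Mxy.
have [|Mx] := pselect (M x); [by left|right].
have [r [u [Mu e]]] := maximal_comax maxM Mx.
rewrite -(mul1r y) e mulrDl -mulrA; apply: idealD => //.
  exact: ideal_mull.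
exact: ideal_mulr.
Qed.

Lemma regular_local_frob_flat (p : nat) : regular_local A -> p \in [pchar A] ->
  exists2 m, (forall M, is_maximal M <-> M = m) &
  forall e d f g, ~ frob_pow p m e f ->
    frob_pow p m (e + d) (f ^+ (p ^ d) * g) -> frob_pow p m d g.
Proof.
move=> [noeA [m [Hm [n [[[P [pP ltP]] _] [x em]]]]]] charp; exists m => //.
have maxm : is_maximal m by exact/Hm.
have pm := maximal_prime maxm.
have proper_sub I : is_ideal I -> ~ I 1 -> I `<=` m.
  by move=> idI I1; have [M /Hm ->] := exists_maximal noeA idI I1.
have subm Q : is_prime Q -> Q `<=` m by case=> idQ Q1 _; exact: proper_sub.
have unitm t : ~ m t -> exists s, s * t = 1.
  move=> mt; have [[s e]|t1] := pselect (ideal_princ t 1); first by exists s.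
  case: mt; apply: (proper_sub _ _ t1); first exact: ideal_princ_ideal.
  exact: ideal_princ_id.
have chP := chain_above_prime_chain pP ltP.
move=> e d f g; rewrite !(frob_pow_maximal em _ charp) => nf.
exact: (pow_ideal_flat noeA pm subm unitm em chP charp nf).
Qed.

End MaximalIdeals.

Local Notation "x %:F" := (@FracField.tofrac _ x).

(** * Transfer between a domain and its localization *)

Section LocalizationAtMaximal.
Variables (R : idomainType) (P : prime_ideal R).
Local Notation A := (localization P).
Local Notation PS := (prime_set P).
Implicit Types (a b s t : R) (z w : A).

Lemma tofrac_loc_pred a : a%:F \in loc_pred P.
Proof.
have [_ P1 _] := prime_setP P.
by apply/asboolP; exists a, 1; rewrite tofrac1 divr1.
Qed.

Definition to_loc a : A := Sub (a%:F) (tofrac_loc_pred a).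

Lemma to_locD : {morph to_loc : a b / a + b}.
Proof. by move=> a b; apply: val_inj; rewrite rmorphD /= tofracD. Qed.

Lemma to_locM : {morph to_loc : a b / a * b}.
Proof. by move=> a b; apply: val_inj; rewrite rmorphM /= tofracM. Qed.

Lemma to_loc0 : to_loc 0 = 0.
Proof. by apply: val_inj; rewrite rmorph0 /= tofrac0. Qed.

Lemma to_loc1 : to_loc 1 = 1.
Proof. by apply: val_inj; rewrite rmorph1 /= tofrac1. Qed.

Lemma to_locX (n : nat) : {morph to_loc : a / a ^+ n}.
Proof. by move=> a; elim: n => [|n IH]; rewrite ?to_loc1 // !exprS to_locM IH. Qed.

Lemma to_loc_inj : injective to_loc.
Proof. by move=> a b /(congr1 val) /= /eqP; rewrite tofrac_eq => /eqP. Qed.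

Lemma to_loc_frac z : exists a s, ~ PS s /\ z * to_loc s = to_loc a.
Proof.
have /asboolP[a [s [Ps e]]] := valP z; exists a, s; split=> //.
apply: val_inj; rewrite rmorphM /= e divfK // tofrac_eq0.
by apply/eqP => s0; apply: Ps; rewrite s0; exact: (ideal0 (prime_ideal_ideal (prime_setP P))).
Qed.

Lemma to_loc_unit s : ~ PS s -> exists z, z * to_loc s = 1.
Proof.
move=> Ps.
have Hs : (1%:F / s%:F : {fraction R}) \in loc_pred P by apply/asboolP; exists 1, s.
pose w : A := Sub (1%:F / s%:F) Hs; exists w.
apply: val_inj; rewrite rmorphM rmorph1 /= tofrac1 divfK //.
rewrite tofrac_eq0.
by apply/eqP => s0; apply: Ps; rewrite s0; exact: (ideal0 (prime_ideal_ideal (prime_setP P))).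
Qed.

Lemma loc_pchar p : p \in [pchar R] -> p \in [pchar A].
Proof.
move=> /andP[pp /eqP p0]; apply/andP; split=> //; apply/eqP; apply: val_inj.
rewrite rmorph_nat rmorph0 /=.
by rewrite -(rmorph_nat (@FracField.tofrac R)) p0 rmorph0.
Qed.

Lemma loc_maximal :
  is_maximal [set z : A | exists a s, [/\ ~ PS s, PS a & z * to_loc s = to_loc a]].
Proof.
have pP := prime_setP P; have idP := prime_ideal_ideal pP.
have [_ P1 _] := pP.
split.
- split=> /=.
  + by exists 0, 1; split; rewrite ?to_loc0 ?mul0r //; exact: ideal0.
  + move=> z w [a [s [Ps Pa e]]] [b [t [Pt Pb e']]].
    exists (t * a + s * b), (s * t); split; first exact: prime_mulN.
      by apply: idealD => //; exact: ideal_mull.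
    by rewrite to_locD !to_locM -e -e'; ring.
  + move=> w z [a [s [Ps Pa e]]]; have [b [t [Pt e']]] := to_loc_frac w.
    exists (b * a), (t * s); split; [exact: prime_mulN|exact: ideal_mull|].
    by rewrite !to_locM -e -e'; ring.
- move=> /= [a [s [Ps Pa]]]; rewrite mul1r => /to_loc_inj e.
  by apply: Ps; rewrite e.
- move=> I idI HI I1; apply/seteqP; split=> // z Iz.
  have [a [s [Ps e]]] := to_loc_frac z; exists a, s; split=> //.
  apply: contrapT => Pa; have [w ew] := to_loc_unit Pa.
  by apply: I1; rewrite -ew -e; apply: ideal_mull => //; exact: ideal_mulr.
Qed.

End LocalizationAtMaximal.

(** Flatness descends from the localization because Frobenius powers of [M] are contracted from it:
    an element outside [M] is invertible modulo each of them. *)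
Lemma frob_flat_maximal (R : idomainType) (p : nat) (M : set R) :
  regular_domain R -> p \in [pchar R] -> is_maximal M ->
  forall e d f g, ~ frob_pow p M e f ->
    frob_pow p M (e + d) (f ^+ (p ^ d) * g) -> frob_pow p M d g.
Proof.
move=> [_ regR] charp maxM.
have p_gt0 : (0 < p)%N by exact/prime_gt0/(pcharf_prime charp).
have pM := maximal_prime maxM; pose P := PrimeIdeal pM.
have idM := prime_ideal_ideal pM.
have [m Hm flat] := regular_local_frob_flat (regR P) (loc_pchar P charp).
have {Hm} em := (Hm _).1 (loc_maximal P).
have to_m e f : frob_pow p M e f -> frob_pow p m e (to_loc P f).
  have idm : is_ideal (frob_pow p m e) by exact: ideal_gen_ideal.
  have idc : is_ideal [set f | frob_pow p m e (to_loc P f)].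
    split=> /=.
    - by rewrite to_loc0; exact: ideal0.
    - by move=> y z Hy Hz; rewrite to_locD; exact: (idealD idm).
    - by move=> r y Hy; rewrite to_locM; exact: (ideal_mull _ idm).
  apply: (ideal_gen_min idc) => _ [y My <-] /=.
  apply: sub_ideal_gen; exists (to_loc P y); last by rewrite to_locX.
  rewrite -em; exists y, 1; split=> //; first by case: (pM).
  by rewrite to_loc1 mulr1.
have of_m e f : frob_pow p m e (to_loc P f) -> frob_pow p M e f.
  have idMe : is_ideal (frob_pow p M e) by exact: ideal_gen_ideal.
  pose W := [set w | exists b t, [/\ frob_pow p M e b, ~ M t &
                                     w * to_loc P t = to_loc P b]].
  have idW : is_ideal W.
    split=> /=.
    - exists 0, 1; split; rewrite ?to_loc0 ?mul0r //; first exact: ideal0.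
      by case: (pM).
    - move=> z w [a [s [Ha Ms e1]]] [b [t [Hb Mt e2]]].
      exists (t * a + s * b), (s * t); split; last by rewrite to_locD !to_locM -e1 -e2; ring.
        by apply: (idealD idMe); exact: (ideal_mull _ idMe).
      exact: prime_mulN.
    - move=> w z [a [s [Ha Ms e1]]]; have [b [t [Mt e2]]] := to_loc_frac w.
      exists (b * a), (t * s); split; last by rewrite !to_locM -e1 -e2; ring.
        exact: (ideal_mull _ idMe).
      exact: prime_mulN.
  move=> /(ideal_gen_min idW)[|b [t [Hb Mt]]].
    move=> _ [z + <-]; rewrite -em => -[a [s [Ms Ma e1]]].
    exists (a ^+ (p ^ e)), (s ^+ (p ^ e)); split.
    - by apply: sub_ideal_gen; exists a.
    - exact: prime_exprN.
    - by rewrite !to_locX -e1 exprMn.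
  rewrite -to_locM => /to_loc_inj ft.
  have [r [u [Mu e1]]] := maximal_comax maxM Mt.
  (* This is [1 = r * t + u] raised to the power [p ^ e], then multiplied by [f]. *)
  have -> : f = f * t * (r ^+ (p ^ e) * t ^+ (p ^ e).-1) + f * u ^+ (p ^ e).
    have -> : f * t * (r ^+ (p ^ e) * t ^+ (p ^ e).-1) = f * (r * t) ^+ (p ^ e).
      by rewrite exprMn -(@prednK (p ^ e)%N) ?expn_gt0 ?p_gt0 // [t ^+ _.+1]exprS; ring.
    by rewrite -mulrDr -exprDn_frob // -e1 expr1n mulr1.
  apply: (idealD idMe); first by rewrite ft; exact: (ideal_mulr _ idMe).
  by apply: (ideal_mull _ idMe); apply: sub_ideal_gen; exists u.
move=> e d f g nf /to_m; rewrite to_locM to_locX => H.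
by apply: (of_m); apply: flat H => /of_m.
Qed.

(** * Frobenius powers of ideals *)

Section FrobeniusPowers.
Variables (A : comNzRingType) (p : nat).
Hypothesis charp : p \in [pchar A].
Implicit Types (I J N a : set A) (x y z : A) (e d k l : nat).

Lemma ideal_mulS I I' J J' : I `<=` I' -> J `<=` J' ->
  ideal_mul I J `<=` ideal_mul I' J'.
Proof.
move=> II' JJ'; apply: ideal_mul_sub; first exact: ideal_mul_ideal.
by move=> x y /II' Ix /JJ' Jy; exact: ideal_mul_mem.
Qed.

Lemma ideal_mulC I J : ideal_mul I J = ideal_mul J I.
Proof.
by apply/seteqP; split; apply: ideal_mul_sub; [exact: ideal_mul_ideal| |
  exact: ideal_mul_ideal|]; move=> x y Ix Jy; rewrite mulrC; exact: ideal_mul_mem.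
Qed.

Lemma ideal_mul_assoc_sub I J N :
  ideal_mul I (ideal_mul J N) `<=` ideal_mul (ideal_mul I J) N.
Proof.
apply: ideal_mul_sub; first exact: ideal_mul_ideal.
move=> x y Ix Jy; rewrite mulrC.
apply: (ideal_mul_sub (ideal_colon_ideal x (@ideal_mul_ideal _ _ N)) _ Jy).
move=> u v Ju Nv; rewrite /ideal_colon /= mulrC mulrA.
by apply: ideal_mul_mem => //; exact: ideal_mul_mem.
Qed.

Lemma ideal_mulA I J N : ideal_mul I (ideal_mul J N) = ideal_mul (ideal_mul I J) N.
Proof.
apply/seteqP; split; first exact: ideal_mul_assoc_sub.
rewrite ideal_mulC (ideal_mulC I J) (ideal_mulC I) (ideal_mulC J N).
exact: ideal_mul_assoc_sub.
Qed.

Lemma ideal_mulTI I : is_ideal I -> ideal_mul setT I = I.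
Proof.
move=> idI; apply/seteqP; split; last by move=> x Ix; rewrite -(mul1r x); exact: ideal_mul_mem.
by apply: ideal_mul_sub => // x y _; exact: ideal_mull.
Qed.

Lemma frob_pow_ideal I e : is_ideal (frob_pow p I e).
Proof. exact: ideal_gen_ideal. Qed.

Lemma frob_pow_mem I e x : I x -> frob_pow p I e (x ^+ (p ^ e)).
Proof. by move=> Ix; apply: sub_ideal_gen; exists x. Qed.

Lemma frob_pow_sub I N e : is_ideal N -> (forall x, I x -> N (x ^+ (p ^ e))) ->
  frob_pow p I e `<=` N.
Proof. by move=> idN IN; apply: ideal_gen_min => // _ [x Ix <-]; exact: IN. Qed.

Lemma frob_powS I J e : I `<=` J -> frob_pow p I e `<=` frob_pow p J e.
Proof.
move=> IJ; apply: frob_pow_sub; first exact: frob_pow_ideal.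
by move=> x /IJ; exact: frob_pow_mem.
Qed.

Lemma frob_pow_subset I e : is_ideal I -> frob_pow p I e `<=` I.
Proof.
move=> idI; apply: frob_pow_sub => // x Ix.
have /prednK <- : (0 < p ^ e)%N by rewrite expn_gt0 prime_gt0 ?(pcharf_prime charp).
by rewrite exprS; exact: ideal_mulr.
Qed.

Lemma frob_pow0 I : is_ideal I -> frob_pow p I 0 = I.
Proof.
move=> idI; apply/seteqP; split; first exact: frob_pow_subset.
by move=> x Ix; rewrite -[x]expr1; exact: frob_pow_mem.
Qed.

Lemma frob_powT e : frob_pow p (@setT A) e = setT.
Proof.
apply: ideal1_setT; first exact: frob_pow_ideal.
by rewrite -(expr1n _ (p ^ e)); exact: frob_pow_mem.
Qed.

Lemma frob_preimage_ideal N e : is_ideal N -> is_ideal [set x | N (x ^+ (p ^ e))].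
Proof.
move=> idN; split=> /=.
- rewrite expr0n expn_eq0 eqn0Ngt prime_gt0 ?(pcharf_prime charp) //; exact: ideal0.
- by move=> x y Nx Ny; rewrite exprDn_frob //; exact: idealD.
- by move=> r x Nx; rewrite exprMn; exact: ideal_mull.
Qed.

Lemma frob_pow_comp I d e : frob_pow p (frob_pow p I d) e = frob_pow p I (d + e).
Proof.
apply/seteqP; split; apply: frob_pow_sub; try exact: frob_pow_ideal; move=> x.
  apply: (frob_pow_sub (frob_preimage_ideal e (@frob_pow_ideal I (d + e)))).
  by move=> y Iy /=; rewrite -exprM -expnD; exact: frob_pow_mem.
by move=> Ix; rewrite expnD exprM; do 2!apply: frob_pow_mem.
Qed.

Lemma frob_pow_mul I J e :
  frob_pow p (ideal_mul I J) e = ideal_mul (frob_pow p I e) (frob_pow p J e).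
Proof.
apply/seteqP; split.
  apply: frob_pow_sub; first exact: ideal_mul_ideal.
  apply: (ideal_mul_sub (frob_preimage_ideal e (@ideal_mul_ideal _ _ _))).
  by move=> x y Ix Jy /=; rewrite exprMn; apply: ideal_mul_mem; exact: frob_pow_mem.
have idF := @frob_pow_ideal (ideal_mul I J) e.
apply: ideal_mul_sub => // x y Hx.
rewrite mulrC; apply: (frob_pow_sub (ideal_colon_ideal x idF)) => z Jz.
rewrite /ideal_colon /= mulrC.
apply: (frob_pow_sub (ideal_colon_ideal _ idF) _ Hx) => w Iw.
by rewrite /ideal_colon /= -exprMn; apply: frob_pow_mem; exact: ideal_mul_mem.
Qed.

Lemma digit_pow_ideal a k : is_ideal (digit_pow p a k).
Proof. by rewrite /digit_pow big_ord_recl; exact: ideal_mul_ideal. Qed.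

Lemma digit_pow0 a : digit_pow p a 0 = setT.
Proof.
rewrite /digit_pow trunc_log0 big_ord_recl big_ord0 div0n mod0n frob_pow0.
  by rewrite ideal_mulTI //; exact: idealT.
exact: idealT.
Qed.

(** Splitting off the lowest digit turns the product over digits into a recursion on [k %/ p]. For
    [k < p] the quotient is 0 and its power is the whole ring. *)
Lemma digit_powE a k : digit_pow p a k =
  ideal_mul (ideal_pow a (k %% p)) (frob_pow p (digit_pow p a (k %/ p)) 1).
Proof.
have p_gt1 := prime_gt1 (pcharf_prime charp).
rewrite {1}/digit_pow big_ord_recl expn0 divn1 frob_pow0; last exact: ideal_pow_ideal.
congr ideal_mul; have [ltkp|lepk] := ltnP k p.
  rewrite divn_small // digit_pow0 frob_powT.
  have -> : trunc_log p k = 0%N.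
    by apply/eqP; rewrite trunc_log_eq0; lia.
  by rewrite big_ord0.
have -> : trunc_log p k = (trunc_log p (k %/ p)).+1.
  have kp_gt0 : (0 < k %/ p)%N by rewrite divn_gt0 // prime_gt0 ?(pcharf_prime charp).
  apply: trunc_log_eq => //; apply/andP; split.
    by rewrite expnSr -leq_divRL ?(ltnW p_gt1) // trunc_logP.
  by rewrite expnSr -ltn_divLR ?(ltnW p_gt1) // trunc_log_ltn.
rewrite /digit_pow (big_morph (fun I => frob_pow p I 1) (fun I J => frob_pow_mul I J 1)
  (frob_powT 1)).
apply: eq_bigr => i _.
by rewrite frob_pow_comp addn1 lift0 expnS divnMA.
Qed.

(** As [k < p ^ e], the digits of [k] and of [p ^ e * l] occupy disjoint positions, so there are no
    carries. *)
Lemma digit_pow_add a k l e : (k < p ^ e)%N -> digit_pow p a (k + p ^ e * l) =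
  ideal_mul (digit_pow p a k) (frob_pow p (digit_pow p a l) e).
Proof.
have p_gt0 := prime_gt0 (pcharf_prime charp).
elim: e k => [|e IH] k.
  rewrite ltnS leqn0 => /eqP ->; rewrite mul1n digit_pow0 frob_pow0.
    by rewrite ideal_mulTI //; exact: digit_pow_ideal.
  exact: digit_pow_ideal.
move=> ltk; rewrite digit_powE (digit_powE a k) expnS -mulnA.
rewrite (addnC k) (mulnC p) modnMDl divnMDl // addnC IH; last first.
  by rewrite ltn_divLR // mulnC -expnS.
by rewrite frob_pow_mul frob_pow_comp addn1 ideal_mulA.
Qed.

(** Without a carry only the lowest digit grows. With a carry, induction on the quotient yields a
    factor [a^[p]], which is absorbed into [a^p], the product of [a] and the old lowest factor. *)
Lemma digit_powS a k : digit_pow p a k.+1 `<=` ideal_mul a (digit_pow p a k).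
Proof.
have p_gt0 := prime_gt0 (pcharf_prime charp).
have p_gt1 := prime_gt1 (pcharf_prime charp).
elim/ltn_ind: k => k IH; rewrite digit_powE (digit_powE a k) ideal_mulA.
have := ltn_pmod k p_gt0; rewrite leq_eqVlt => /orP[/eqP ek|ltk].
  have ek1 : k.+1 = ((k %/ p).+1 * p)%N by rewrite {1}(divn_eq k p) -addnS ek mulSn addnC.
  rewrite ek1 modnMl mulnK // ideal_mulTI; last exact: frob_pow_ideal.
  apply: subset_trans (frob_powS (IH _ _)) _.
    by rewrite ltn_Pdiv //; case: k ek {IH ek1} => //; rewrite mod0n => e1; rewrite -e1 in p_gt1.
  rewrite frob_pow_mul; apply: ideal_mulS => //.
  have -> : ideal_mul a (ideal_pow a (k %% p)) = ideal_pow a p by rewrite -{2}ek.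
  apply: frob_pow_sub; first exact: ideal_pow_ideal.
  by move=> x ax; rewrite expn1; exact: ideal_pow_expr.
have -> : (k.+1 %% p = (k %% p).+1)%N.
  by rewrite -addn1 -modnDml addn1 modn_small.
have -> // : (k.+1 %/ p = k %/ p)%N.
by rewrite {1}(divn_eq k p) -addnS divnMDl // (divn_small ltk) addn0.
Qed.

Lemma digit_pow_anti a k l : (k <= l)%N -> digit_pow p a l `<=` digit_pow p a k.
Proof.
move=> /subnK <-; elim: (l - k)%N => [//|d IH]; rewrite addSn.
apply: subset_trans (@digit_powS _ _) _; apply: subset_trans IH.
apply: ideal_mul_sub; first exact: digit_pow_ideal.
by move=> x y _; apply: (ideal_mull _ (@digit_pow_ideal _ _)).
Qed.

(** A proper ideal competing in the intersection would lie in some maximal [M], and its Frobenius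
    power in that of [M]. *)
Lemma frob_root_setT a e : noetherian A ->
  (forall M, is_maximal M -> ~ a `<=` frob_pow p M e) -> frob_root p a e = setT.
Proof.
move=> noeA Ha; apply/seteqP; split=> // x _ c [idc ac].
suff -> : c = setT by [].
apply: ideal1_setT => //; apply: contrapT => c1.
have [M maxM cM] := exists_maximal noeA idc c1.
by apply: (Ha M maxM); apply: subset_trans ac _; exact: frob_powS.
Qed.

Section FlatAtMaximal.
Variable M : set A.
Hypothesis maxM : is_maximal M.
Hypothesis flatM : forall e d f g, ~ frob_pow p M e f ->
  frob_pow p M (e + d) (f ^+ (p ^ d) * g) -> frob_pow p M d g.

Lemma frob_pow_maximal1 e : ~ frob_pow p M e 1.
Proof. by case: maxM => idM M1 _ /(frob_pow_subset idM). Qed.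

Lemma frob_pow_cancel e d f : frob_pow p M (e + d) (f ^+ (p ^ d)) -> frob_pow p M e f.
Proof.
rewrite -[f ^+ _]mulr1 => H; apply: contrapT => nf.
exact: (frob_pow_maximal1 (flatM nf H)).
Qed.

(* Compare [l / p^d] and [k / p^e] after a Frobenius power [e], then cancel it. *)
Lemma digit_pow_sub_frob a k e l d : (k * p ^ d <= l * p ^ e)%N ->
  digit_pow p a k `<=` frob_pow p M e -> digit_pow p a l `<=` frob_pow p M d.
Proof.
have p_gt0 := prime_gt0 (pcharf_prime charp).
have shift b c : digit_pow p a (b * p ^ c) = frob_pow p (digit_pow p a b) c.
  rewrite mulnC -[(_ * _)%N]add0n digit_pow_add ?expn_gt0 ?p_gt0 //.
  by rewrite digit_pow0 ideal_mulTI //; exact: frob_pow_ideal.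
move=> le_kl ke f lf; apply: (@frob_pow_cancel d e).
rewrite addnC -frob_pow_comp; apply: (frob_powS ke).
by rewrite -shift; apply: (digit_pow_anti le_kl); rewrite shift; exact: frob_pow_mem.
Qed.

(** The witness is built by [F := f * F ^+ (p ^ e)]: this inserts the digits of [k] below the
    previous ones, and flatness cancels the power of [F], which would leave [f] in the Frobenius
    power of [M]. *)
Lemma digit_pow_geometric a k e n : (k < p ^ e)%N ->
  ~ digit_pow p a k `<=` frob_pow p M e ->
  ~ digit_pow p a (k * \sum_(i < n) (p ^ e) ^ i) `<=` frob_pow p M (e * n).
Proof.
move=> ltk /existsNP[f /not_implyP[kf Mf]].
suff [F HF MF] : exists2 F, digit_pow p a (k * \sum_(i < n) (p ^ e) ^ i) F &
    ~ frob_pow p M (e * n) F by move=> /(_ F HF).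
elim: n => [|n [F HF MF]].
  by rewrite big_ord0 !muln0 digit_pow0; exists 1; last exact: frob_pow_maximal1.
exists (f * F ^+ (p ^ e)); last first.
  by rewrite mulrC mulnS addnC => /(flatM MF).
rewrite big_ord_recl expn0 mulnDr muln1.
under eq_bigr do rewrite lift0 expnS.
rewrite -big_distrr /= mulnCA digit_pow_add //.
by apply: ideal_mul_mem => //; exact: frob_pow_mem.
Qed.

End FlatAtMaximal.
End FrobeniusPowers.

(** * Excluding the interval *)

Theorem corollary5p9 (K : realType) (p : nat) (R : idomainType)
    (charRp : p \in [pchar R]) (RFfin : F_finite p R)
    (Rreg : regular_domain R)
    (a : set R) (a_ideal : is_ideal a)
    (a_neq0 : a <> [set 0]) (a_proper : a <> setT)
    (e k : nat) (e_gt0 : (1 <= e)%N) (le_k : (k <= p ^ e - 1)%N) :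
  lce p K a \notin `](k%:R / (p ^ e)%:R), (k%:R / ((p ^ e)%:R - 1))[.
Proof.
have p_prime := pcharf_prime charRp; have p_gt0 := prime_gt0 p_prime.
have q_gt1 : (1 < p ^ e)%N.
  by apply: leq_trans (prime_gt1 p_prime) _; rewrite -{1}(expn1 p) leq_exp2l ?prime_gt1.
have ltk : (k < p ^ e)%N by lia.
have flatR M (maxM : is_maximal M) := frob_flat_maximal Rreg charRp maxM.
apply/negP; rewrite in_itv /= => /andP[lt_lce lce_lt].
set q : K := (p ^ e)%:R in lt_lce lce_lt.
have q1_gt0 : 0 < q - 1 by rewrite subr_gt0 /q ltr1n.
have q_gt0 : 0 < q by lra.
have q_neq0 : q != 0 by rewrite gt_eqF.
pose S := [set t : K | 0 < t /\ real_pow p a t = setT].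
rewrite -/S -[lce p K a]/(sup S) in lt_lce lce_lt.
have lce_gt0 : 0 < sup S by apply: le_lt_trans lt_lce; rewrite divr_ge0 // ltW.
(* [sup] takes the default value 0 when there is no supremum, which positivity rules out. *)
have supS : has_sup S.
  by apply: contrapT => /sup_out e0; rewrite e0 ltxx in lce_gt0.
(* Some [t > k / q] has [a^[t]] equal to the ring, so 1 lies in [a^[l / p^n]] with [l / p^n >= t].
   Containment for [k / q] would pass to [l / p^n], making [M] one of the ideals intersected
   there. *)
have notM M : is_maximal M -> ~ digit_pow p a k `<=` frob_pow p M e.
  move=> maxM kM; have [idM M1 _] := maxM.
  have [|t [t_gt0 at1]] := @sup_adherent K S (sup S - k%:R / q) _ supS.
    by rewrite subr_gt0.
  rewrite subKr => ltkt.
  have : real_pow p a t 1 by rewrite at1.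
  move=> [n _]; set l := `|_|%N => /(_ M) H; apply/M1/H; split=> //.
  apply: (digit_pow_sub_frob charRp maxM (flatR M maxM) _ kM).
  have pn_gt0 : 0 < (p%:R ^+ n : K) by rewrite exprn_gt0 ?ltr0n.
  have : p%:R ^+ n * t <= l%:R.
    rewrite /l natr_absz ger0_norm; first exact: ceil_ge.
    by rewrite ceil_ge0 (lt_trans (ltrN10 _)) // mulr_gt0.
  rewrite -(ler_nat K) !natrM natrX -/q => le_l.
  rewrite ltr_pdivrMr // in ltkt.
  by have := ler_wpM2r (ltW q_gt0) le_l; have := ltr_pM2l pn_gt0 k%:R (t * q); rewrite ltkt; nra.
pose L n := (k * \sum_(i < n) (p ^ e) ^ i)%N.
have LE n : (L n)%:R = k%:R / (q - 1) * (q ^+ n - 1) :> K.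
  rewrite /L natrM natr_sum subrX1.
  under eq_bigr do rewrite natrX -/q.
  by field; rewrite gt_eqF.
have LS n : sup S < (L n)%:R / q ^+ n -> S ((L n)%:R / q ^+ n).
  move=> ltL; split; first exact: lt_trans ltL.
  (* At denominator [p ^ (e * n) = q ^ n] the ceiling is exactly [L n]. *)
  apply/seteqP; split=> // x _; exists (e * n)%N => //.
  have -> : p%:R ^+ (e * n) * ((L n)%:R / q ^+ n) = (L n)%:R :> K.
    by rewrite exprM -natrX -/q mulrCA mulfV ?mulr1 // expf_neq0.
  rewrite pmulrn intrKceil absz_nat /frac_pow.
  rewrite frob_root_setT //; first by case: Rreg.
  move=> M maxM; apply: (digit_pow_geometric charRp maxM (flatR M maxM) ltk).
  exact: notM.
pose c := k%:R / (q - 1); pose D := c - sup S.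
have D_gt0 : 0 < D by rewrite subr_gt0.
have c_ge0 : 0 <= c by rewrite divr_ge0 // ltW.
(* Since [L n / q^n = c - c / q^n], this choice of [n] makes the gap to [c] smaller than [D], so
   [L n / q^n] exceeds [sup S]. *)
have [n ltn] : exists n, c / D < q ^+ n.
  have : c / D < (Num.bound (c / D))%:R by apply: archi_boundP; rewrite divr_ge0 // ltW.
  move: (Num.bound _) => n ltn; exists n; apply: lt_trans ltn _.
  by rewrite /q -natrX ltr_nat ltn_expl.
have qn_gt0 : 0 < q ^+ n by exact: exprn_gt0.
have ltL : sup S < (L n)%:R / q ^+ n.
  rewrite LE -/c ltr_pdivlMr // mulrBr mulr1.
  by rewrite ltr_pdivrMr // /D in ltn; lra.
by have := sup_upper_bound supS (LS n ltL); rewrite leNgt ltL.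
Qed.
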